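(* For all integers $k,w,r,n$ with $2\le k\le w<r\le n/2$ and $$(n+k-1-w)^{\frac{k-1}{k}}\le r\le (n+k-w)^{\frac{k}{k+1}},$$ we have $$N(n,(w,r))\ \ge\ \frac{k^k\,k!}{2(k+1)^{2k}}\cdot\frac{r^{w+1}}{(w+1)!\,\ln^k r}\ =\ \Omega\!\left(\frac{\sqrt{k}}{e^k}\cdot\frac{r^{w+1}}{(w+1)!\,\ln^{k+1} r}\,\log n\right).$$ Moreover, if $r=\Omega\big((n\log n)^{\frac{w}{w+1}}\big)$, then $N(n,(w,r))=\Theta\big(\binom{n}{w}\big)$.
   Context: Let $X$ be a finite set with $|X|=t$ and let $\mathcal{F}$ be a set of subsets (blocks) of $X$. The pair $(X,\mathcal{F})$ is a $(w,r)$-cover-free family ($(w,r)$-CFF) if for any $w$ blocks $A_1,\ldots,A_w\in\mathcal{F}$ and any other $r$ blocks $B_1,\ldots,B_r\in\mathcal{F}$ (distinct from the $A_i$) we have $\bigcap_{i=1}^w A_i\not\subseteq\bigcup_{j=1}^r B_j$. $N(n,(w,r))$ denotes the minimum number of points $|X|$ in any $(w,r)$-CFF with $|\mathcal{F}|=n$ blocks. Throughout, $w\le r$. Asymptotic notation $\Omega,\Theta$ refers to $n,r\to\infty$. *)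

(* Defs.v *)
From mathcomp Require Import all_boot.

Set Implicit Arguments.
Unset Strict Implicit.
Unset Printing Implicit Defensive.

(* The w blocks A_1, ..., A_w are the elements of the family [A], the r other *)
(* blocks B_1, ..., B_r those of [B].                                         *)
Definition cover_free (T : finType) (w r : nat) (F : {set {set T}}) : bool :=
  [forall A : {set {set T}}, forall B : {set {set T}},
    [&& A \subset F, B \subset F, #|A| == w, #|B| == r & [disjoint A & B]]
    ==> ~~ (\bigcap_(S in A) S \subset \bigcup_(S in B) S)].

Definition has_cff (n w r t : nat) : bool :=
  [exists F : {set {set 'I_t}}, (#|F| == n) && cover_free w r F].

(* Take the subsets of 'I_n as points, the i-th block consisting of those     *)
(* that contain i: the subset of indices of the A_i's lies in no B_j.         *)
Lemma has_cff_exists (n w r : nat) : exists t, has_cff n w r t.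
Proof.
exists #|{: {set 'I_n}}|; apply/existsP.
pose blk (i : 'I_n) : {set 'I_#|{: {set 'I_n}}|} :=
  [set p | i \in (enum_val p : {set 'I_n})].
have blk_inj : injective blk.
  move=> i j /setP/(_ (enum_rank [set i])).
  by rewrite !inE !enum_rankK !inE eqxx => /esym/eqP.
exists [set blk i | i in 'I_n]; apply/andP; split.
  by rewrite card_imset // card_ord.
apply/forallP => A; apply/forallP => B; apply/implyP.
case/and5P => /subsetP sA /subsetP sB _ _ dAB.
apply/subsetPn; exists (enum_rank [set i | blk i \in A]).
  apply/bigcapP => S SA; have /imsetP[i _ defS] := sA _ SA.
  by rewrite defS inE enum_rankK inE -defS.
apply/bigcupP => -[S SB]; have /imsetP[i _ defS] := sB _ SB.
rewrite defS inE enum_rankK inE -defS => SA.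
by move/disjointFr: dAB => /(_ _ SA); rewrite SB.
Qed.

(* N(n,(w,r)). Up to relabelling, a set of t points is 'I_t.                  *)
Definition cffN (n w r : nat) : nat := ex_minn (has_cff_exists n w r).

(* Main.v *)
Require Import Defs.
From mathcomp Require Import all_boot all_order all_algebra.
From mathcomp Require Import reals sequences exp.
From mathcomp Require Import ring lra zify.

(* Let [t] be the number of points. Some [d] of the [r] forbidden blocks,     *)
(* chosen greedily, meet every point lying in more than [M = n ln t / d]      *)
(* blocks. Let [e = r - d]. A [w]-set of the remaining blocks is then either  *)
(* exactly the set of blocks through some light point, or contained in the    *)
(* block sets of more than [e] light points, since otherwise [e] further      *)
(* blocks would hit all of these. Counting pairs gives                        *)
(*   'C(n - d, w) <= t * (1 + M ^ w / (w! * (e + 1))).                        *)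
(* With [d = r / 2] this yields the order ['C(n, w)]. For the explicit bound, *)
(* [w = k] and [d = k r / (k + 1)] optimise [d ^ k * (r - d)]; larger [w] are *)
(* reached by fixing one block, N(n,(w,r)) >= N(n-1,(w-1,r)) + N(n-1,(w,r-1)).*)

Set Implicit Arguments.
Unset Strict Implicit.
Unset Printing Implicit Defensive.

Import Order.TTheory GRing.Theory Num.Theory.

(** * Combinatorics of cover-free families *)

(** Write [t] for the number of points. The [r] forbidden blocks are spent in two batches. The first
    [d], found by [greedy_hitting_set], destroy every point of high degree; the other [e], for a
    given [w]-set [W] of blocks, are to hit the light points through [W] outside [W]. Cover-freeness
    makes this fail, so more than [e] light points pass through [W], unless [W] is the whole trace
    of a light point. A light point has few [w]-subsets, so counting in [card_ksubsets_leq], put in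
    analytic form by [cff_on_bin_le], bounds [t] from below.

    Equal batches give the order ['C(n, w)] once [r^(w+1)] is at least of order [(n ln n)^w]
    ([cffN_bin_lower]); [cffN_le_bin] is the matching construction. For the explicit bound,
    [cff_on_base] treats [w = k] under [r^(k+1) <= n^k], and [cff_on_lower] climbs to larger [w],
    because [r^(w+1) / (w+1)!] is compatible with the recursion obtained by fixing a block. The
    asymptotic form of that bound needs a Stirling estimate ([constant_lower]) and [ln n <= 3 ln r]
    ([bounds_compare]). *)

(* Dual, indexed form: the point [x] is given by the set [S x] of the blocks  *)
(* through it; only the blocks in [V] and the points in [P] are considered.   *)
Definition cff_on (T I : finType) (S : T -> {set I}) (w r : nat)
    (V : {set I}) (P : {set T}) : Prop :=
  forall A B : {set I}, A \subset V -> B \subset V -> #|A| = w -> #|B| = r ->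
    [disjoint A & B] -> exists2 x, x \in P & (A \subset S x) && [disjoint S x & B].

Lemma subset_of_card (I : finType) (A C : {set I}) (k : nat) :
  A \subset C -> #|A| <= k <= #|C| ->
  exists2 B : {set I}, A \subset B /\ B \subset C & #|B| = k.
Proof.
move=> sAC /andP[]; elim: k => [|k IHk].
  by rewrite leqn0 => /eqP A0 _; exists A.
rewrite leq_eqVlt => /orP[/eqP eA _|]; first by exists A.
rewrite ltnS => lA lk; have [B [sAB sBC] cB] := IHk lA (ltnW lk).
have: ~~ (C \subset B).
  by apply: contraL lk => /subset_leq_card; rewrite cB -leqNgt.
case/subsetPn => i iC iB; exists (i |: B); last by rewrite cardsU1 iB cB.
by rewrite subsetU ?sAB ?orbT // subUset sub1set iC.
Qed.

Lemma disjointsU1 (I : finType) (i : I) (A B : {set I}) :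
  [disjoint i |: A & B] = (i \notin B) && [disjoint A & B].
Proof. by rewrite -!setI_eq0 setIUl setU_eq0 !setI_eq0 disjoints1. Qed.

(** Spend [i] as one of the [A]-blocks: every witness then lies on it. In [cff_on_nmem], [i] is
    spent as a [B]-block and every witness avoids it. The two residual families thus live on
    complementary parts of [P], so their point counts add up. *)
Lemma cff_on_mem (T I : finType) (S : T -> {set I}) w r V P i :
  cff_on S w.+1 r V P -> i \in V ->
  cff_on S w r (V :\ i) (P :&: [set x | i \in S x]).
Proof.
move=> cf iV A B; rewrite !subsetD1 => /andP[sA iA] /andP[sB iB] cA cB dAB.
have [|||x xP /andP[sAx dBx]] := cf (i |: A) B _ sB _ cB.
- by rewrite subUset sub1set iV.
- by rewrite cardsU1 iA cA.
- by rewrite disjointsU1 iB.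
exists x; last by rewrite dBx (subset_trans _ sAx) // subsetUr.
by rewrite !inE xP (subsetP sAx) // !inE eqxx.
Qed.

Lemma cff_on_nmem (T I : finType) (S : T -> {set I}) w r V P i :
  cff_on S w r.+1 V P -> i \in V ->
  cff_on S w r (V :\ i) (P :\: [set x | i \in S x]).
Proof.
move=> cf iV A B; rewrite !subsetD1 => /andP[sA iA] /andP[sB iB] cA cB dAB.
have [|||x xP /andP[sAx dBx]] := cf A (i |: B) sA _ cA.
- by rewrite subUset sub1set iV.
- by rewrite cardsU1 iB cB.
- by rewrite disjoint_sym disjointsU1 iA disjoint_sym.
move: dBx; rewrite disjoint_sym disjointsU1 => /andP[iSx dBx].
by exists x; rewrite ?inE ?iSx // sAx disjoint_sym.
Qed.

Lemma cff_on_gt0 (T I : finType) (S : T -> {set I}) w r V P :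
  cff_on S w r V P -> w + r <= #|V| -> 0 < #|P|.
Proof.
move=> cf lV.
have [|A [_ sA] cA] := @subset_of_card _ set0 V w (sub0set _).
  by rewrite cards0 (leq_trans _ lV) // leq_addr.
have [|B [_ sB] cB] := @subset_of_card _ set0 (V :\: A) r (sub0set _).
  by rewrite cards0 cardsD (setIidPr sA) cA leq_subRL // (leq_trans _ lV) // leq_addr.
move: sB; rewrite subsetD => /andP[sB dB].
have [|x xP _] := cf A B sA sB cA cB; first by rewrite disjoint_sym.
by apply/card_gt0P; exists x.
Qed.

(** Splitting the points by a block [i] is Pascal's recursion. The result is the a priori bound from
    which [cff_on_base] learns that [r] is large. *)
Lemma cff_on_bin (T I : finType) (S : T -> {set I}) w r V P :
  cff_on S w r V P -> w + r <= #|V| -> 'C(w + r, w) <= #|P|.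
Proof.
elim: w r V P => [|w IHw] r V P; first by rewrite bin0; apply: cff_on_gt0.
elim: r V P => [|r IHr] V P cf lV; first by rewrite addn0 binn (cff_on_gt0 cf).
have /card_gt0P[i iV]: 0 < #|V| by apply: leq_trans lV.
have lV' : w + r.+1 <= #|V :\ i| by move: lV; rewrite (cardsD1 i V) iV.
rewrite -(cardsID [set x | i \in S x] P) addSn binS addnC leq_add //.
  by apply: IHw lV'; apply: cff_on_mem.
by rewrite -addSnnS (IHr (V :\ i)) ?addSnnS //; apply: cff_on_nmem.
Qed.

Lemma greedy_hitting_set (T I : finType) (S : T -> {set I}) (V : {set I})
    (P : {set T}) (h d : nat) :
  (forall x, x \in P -> h <= #|S x :&: V|) -> d <= #|V| ->
  exists D : {set I}, [/\ D \subset V, #|D| = d &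
    #|[set x in P | [disjoint S x & D]]| * #|V| ^ d <= #|P| * (#|V| - h) ^ d].
Proof.
move=> hP; elim: d => [|d IHd] lV.
  exists set0; rewrite sub0set cards0 !expn0 !muln1; split=> //.
  by apply/subset_leq_card/subsetP => x; rewrite inE => /andP[].
have [D [sD cD leD]] := IHd (ltnW lV).
set U := [set x in P | [disjoint S x & D]] in leD.
have cVD : #|V :\: D| = #|V| - d by rewrite cardsD (setIidPr sD) cD.
have /card_gt0P[i0 i0VD]: 0 < #|V :\: D| by rewrite cVD subn_gt0.
pose f i := #|[set x in U | i \in S x]|.
have [i iVD imax] : exists2 i, i \in V :\: D & forall j, j \in V :\: D -> f j <= f i.
  by case: (arg_maxnP f i0VD) => i; exists i.
have sumf : #|U| * h <= #|V| * f i.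
  apply: (@leq_trans (\sum_(j in V :\: D) f j)); last first.
    apply: (@leq_trans (\sum_(j in V :\: D) f i)); first exact: leq_sum.
    by rewrite sum_nat_const leq_mul2r subset_leq_card ?orbT // subsetDl.
  have -> : \sum_(j in V :\: D) f j = \sum_(x in U) #|S x :&: (V :\: D)|.
    under eq_bigr do rewrite /f -sum1_card.
    under [RHS]eq_bigr do rewrite -sum1_card.
    rewrite (exchange_big_dep (mem U)) /=; last by move=> j x _; rewrite inE => /andP[].
    apply: eq_bigr => x xU; apply: eq_bigl => j.
    by rewrite !inE andbC; move: xU; rewrite inE => ->.
  rewrite -sum_nat_const; apply: leq_sum => x; rewrite inE => /andP[xP dx].
  rewrite (leq_trans (hP _ xP)) // subset_leq_card //.
  apply/subsetP => j; rewrite !inE => /andP[jS ->]; rewrite jS andbT.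
  by rewrite (disjointFr dx).
move: (iVD); rewrite inE => /andP[iD iV].
exists (i |: D); split; first by rewrite subUset sub1set iV.
  by rewrite cardsU1 iD cD.
have -> : [set x in P | [disjoint S x & i |: D]] = U :\: [set x in U | i \in S x].
  apply/setP => x; rewrite !inE disjoint_sym disjointsU1 disjoint_sym.
  by case: (x \in P); case: (i \in S x); case: [disjoint S x & D].
have -> : #|U :\: [set x in U | i \in S x]| = #|U| - f i.
  by rewrite cardsD (setIidPr _) //; apply/subsetP => x; rewrite inE => /andP[].
have step : (#|U| - f i) * #|V| <= #|U| * (#|V| - h).
  by rewrite mulnBl mulnBr leq_sub2l // [f i * _]mulnC.
rewrite !expnS mulnA [leqRHS]mulnCA.
apply: (leq_trans (leq_mul step (leqnn _))).
by rewrite mulnAC mulnC leq_mul2l leD orbT.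
Qed.

(** One element is picked from each set. Containment in the union is recorded because the sets will
    be traces with [W] removed, and the transversal must then avoid [W]. *)
Lemma small_transversal (T I : finType) (G : T -> {set I}) (Q : {set T}) :
  (forall x, x \in Q -> G x != set0) ->
  exists E : {set I}, [/\ #|E| <= #|Q|, E \subset \bigcup_(x in Q) G x &
    forall x, x \in Q -> ~~ [disjoint G x & E]].
Proof.
move=> G0; have [-> |[x0 x0Q]] := set_0Vmem Q.
  exists set0; rewrite sub0set cards0; split=> // x; by rewrite inE.
have /set0Pn[i0 _] := G0 _ x0Q.
pose y x := odflt i0 [pick i in G x].
have yG x : x \in Q -> y x \in G x.
  rewrite /y => /G0/set0Pn[i iG]; case: pickP => //= Gx0.
  by rewrite Gx0 in iG.
exists (y @: Q); split; first exact: leq_imset_card.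
  by apply/subsetP => _ /imsetP[x xQ ->]; apply/bigcupP; exists x; rewrite ?yG.
move=> x xQ; apply/negP => /disjointFr/(_ (yG _ xQ)).
by rewrite imset_f.
Qed.

Lemma card_ksubsets_leq (T I : finType) (S : T -> {set I}) (k d e m : nat)
    (V : {set I}) (P : {set T}) :
  cff_on S k (d + e) V P -> k + (d + e) <= #|V| ->
  #|P| * (#|V| - m.+1) ^ d < #|V| ^ d ->
  'C(#|V| - d, k) * e.+1 <= #|P| * ('C(m, k) + e.+1).
Proof.
move=> cf lV few.
have dV : d <= #|V|.
  by apply: leq_trans lV; rewrite (leq_trans (leq_addr e d)) // leq_addl.
pose heavy := [set x in P | m < #|S x :&: V|].
have [|D [sD cD leD]] := @greedy_hitting_set _ _ S V heavy m.+1 d _ dV.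
  by move=> x; rewrite inE => /andP[].
have heavyP : #|heavy| <= #|P|.
  by apply/subset_leq_card/subsetP => x; rewrite inE => /andP[].
(* A surviving heavy point would turn the greedy estimate into
   [#|V| ^ d <= #|P| * (#|V| - m.+1) ^ d], against [few]. *)
have hit x : x \in P -> [disjoint S x & D] -> #|S x :&: V| <= m.
  move=> xP dx; rewrite leqNgt; apply/negP => hx.
  suff: #|V| ^ d < #|V| ^ d by rewrite ltnn.
  apply: leq_ltn_trans few; rewrite (leq_trans _ (leq_mul heavyP (leqnn _))) //.
  apply: leq_trans leD; rewrite leq_pmull //; apply/card_gt0P; exists x.
  by rewrite !inE xP hx.
pose L := [set x in P | [disjoint S x & D]].
have LP : #|L| <= #|P|.
  by apply/subset_leq_card/subsetP => x; rewrite inE => /andP[].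
pose Ws := [set W : {set I} | (W \subset V :\: D) & #|W| == k].
have cWs : #|Ws| = 'C(#|V| - d, k).
  by rewrite cards_draws cardsD (setIidPr sD) cD.
pose cov (W : {set I}) := [set x in L | W \subset S x].
pose own := [set S x :&: V | x in L].
have covP W : W \in Ws -> e < #|cov W| + e.+1 * (W \in own).
  rewrite inE => /andP[]; rewrite subsetD => /andP[sWV dWD] /eqP cW.
  have [_|Wown] := boolP (W \in own); first by rewrite muln1 ltn_addl.
  (* With at most [e] covering points, [D] and a transversal [E] of their traces off [W] fit into
     [d + e] blocks outside [W]. The witness for [W] against these blocks belongs to [cov W] but
     avoids [E], a contradiction. *)
  rewrite muln0 addn0 ltnNge; apply/negP => lcov.
  have [|E [cE sE hE]] := @small_transversal _ _ (fun x => (S x :&: V) :\: W) (cov W).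
    move=> x; rewrite !inE => /andP[xL sWx]; apply: contra Wown => /eqP SW.
    apply/imsetP; exists x; first by rewrite inE.
    apply/eqP; rewrite eqEsubset subsetI sWx sWV /=.
    by rewrite -setD_eq0 SW.
  have EVW : E \subset V :\: W.
    apply: subset_trans sE _; apply/bigcupsP => x _.
    by rewrite setSD // subsetIr.
  have DVW : D \subset V :\: W by rewrite subsetD sD disjoint_sym.
  have [||B [sDEB sBV] cB] := @subset_of_card _ (D :|: E) (V :\: W) (d + e).
  - by rewrite subUset DVW.
  - rewrite cardsD (setIidPr sWV) cW leq_subRL ?lV ?andbT; last first.
      by apply: leq_trans lV; apply: leq_addr.
    by rewrite (leq_trans (leq_card_setU _ _)) // cD leq_add2l (leq_trans cE).
  move: sBV sDEB; rewrite subsetD subUset => /andP[sBV dBW] /andP[sDB sEB].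
  have [|x xP /andP[sWx dxB]] := cf W B sWV sBV cW cB; first by rewrite disjoint_sym.
  have xC : x \in cov W.
    by rewrite !inE xP sWx andbT (disjointWr sDB).
  have /negP[] := hE _ xC; apply: disjointWl (disjointWr sEB dxB).
  by rewrite subDset subIset // subsetUr.
rewrite -cWs -sum_nat_const.
apply: (@leq_trans (\sum_(W in Ws) (#|cov W| + e.+1 * (W \in own)))).
  by apply: leq_sum => W /covP.
(* The first sum is counted by points, each light trace having at most ['C(m, k)] subsets of size
   [k]; the second is at most [e.+1] times the number of light traces. *)
rewrite big_split /= mulnDr leq_add //.
  under eq_bigr do rewrite -sum1_card.
  rewrite (exchange_big_dep (mem L)) /=; last by move=> W x _; rewrite inE => /andP[].
  rewrite (leq_trans _ (leq_mul LP (leqnn _))) // -sum_nat_const leq_sum // => x xL.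
  move: (xL); rewrite inE => /andP[xP dxD].
  apply: leq_trans (leq_bin2l _ (hit x xP dxD)).
  rewrite sum1_card -cards_draws; apply/subset_leq_card/subsetP => W.
  rewrite unfold_in /= !inE.
  move=> /andP[/andP[sW ->] /andP[_ sWx]]; rewrite andbT subsetI sWx.
  exact: subset_trans sW (subsetDl _ _).
rewrite -big_distrr /= mulnC leq_mul2r; apply/orP; right.
rewrite -big_mkcondr sum1_card.
apply: leq_trans LP; apply: leq_trans (leq_imset_card (fun x => S x :&: V) _).
by apply/subset_leq_card/subsetP => W; rewrite unfold_in /= => /andP[].
Qed.

Local Open Scope ring_scope.

(** * Elementary inequalities *)

(** From [e^(-1/12) >= 11/12] one gets [e^(1/12) <= 12/11], whose 36th power is below 24. *)
Lemma expR3_le24 (R : realType) : expR 3 <= 24 :> R.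
Proof.
have h : expR (12%:R^-1) <= 12%:R / 11%:R :> R.
  rewrite -[leLHS]invrK -expRN -[leRHS]invrK lef_pV2 ?posrE ?expR_gt0 //; last by lra.
  by apply: le_trans (expR_ge1Dx _); lra.
have -> : 3 = 36%:R * 12%:R^-1 :> R by lra.
rewrite expRM_natl; apply: le_trans (_ : (12%:R / 11%:R) ^+ 36 <= _).
  by apply: lerXn2r; rewrite ?nnegrE ?expR_ge0 //; lra.
by lra.
Qed.

Lemma bernoulli (R : realType) (x : R) (k : nat) :
  -1 <= x -> 1 + k%:R * x <= (1 + x) ^+ k.
Proof.
move=> x1; elim: k => [|k IHk]; first by rewrite mul0r addr0 expr0.
have x1' : 0 <= 1 + x by lra.
rewrite exprS; apply: le_trans (ler_wpM2l x1' IHk); rewrite -natr1.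
have : 0 <= k%:R * x ^+ 2 by rewrite mulr_ge0 // sqr_ge0.
lra.
Qed.

Lemma bernoulli_nat (a m : nat) : (a ^ m.+1 + m.+1 * a ^ m <= a.+1 ^ m.+1)%N.
Proof.
elim: m => [|m IHm]; first by rewrite !expn1 expn0 muln1 addn1.
rewrite [leqRHS]expnS; apply: leq_trans (leq_mul (leqnn _) IHm).
by rewrite !expnS; nia.
Qed.

(** By Bernoulli [2 (k+1)^(k+1) <= (k+2)^(k+1)], so passing to [k + 1] multiplies the right side by
    at least the [2 (k+1)] gained on the left. *)
Lemma fact_exp2_le (k : nat) : (k`! * 2 ^ k <= k.+1 ^ k)%N.
Proof.
elim: k => // k IHk; apply: leq_trans (bernoulli_nat k.+1 k).
by rewrite factS !expnS; nia.
Qed.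

Lemma ffact_le_exp (n k : nat) : (n ^_ k <= n ^ k)%N.
Proof.
elim: k => // k IHk; rewrite ffactnSr expnSr leq_mul // leq_subr //.
Qed.

Lemma exp_le_ffact (n k : nat) : ((n - k) ^ k <= n ^_ k)%N.
Proof.
elim: k n => // k IHk [|n]; first by rewrite expnS.
by rewrite ffactSS expnS subSS leq_mul // (leq_trans (leq_subr _ _)).
Qed.

Lemma binr_ffact (R : realType) n k : 'C(n, k)%:R = (n ^_ k)%:R / (k`!)%:R :> R.
Proof. by rewrite -bin_ffact natrM mulfK // pnatr_eq0 -lt0n fact_gt0. Qed.

Lemma bin_le_expr (R : realType) n k : 'C(n, k)%:R <= n%:R ^+ k / (k`!)%:R :> R.
Proof.
by rewrite binr_ffact ler_pM2r ?invr_gt0 ?ltr0n ?fact_gt0 // -natrX ler_nat ffact_le_exp.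
Qed.

Lemma expr_le_bin (R : realType) m n k :
  (m + k <= n)%N -> m%:R ^+ k / (k`!)%:R <= 'C(n, k)%:R :> R.
Proof.
move=> h; rewrite binr_ffact ler_pM2r ?invr_gt0 ?ltr0n ?fact_gt0 //.
rewrite -natrX ler_nat (leq_trans _ (exp_le_ffact n k)) //.
by case: k h => // k h; rewrite leq_exp2r // leq_subRL ?(leq_trans (leq_addl _ _) h) // addnC.
Qed.

(** With [M = n a / d] and [m] its integer part, [(1 - (m+1)/n)^d < e^(-a) <= 1/t], which is the
    hypothesis [few]. The free bound [a] on [ln t] will be [(k+1) L] in one use and [w ln n] in the
    other. *)
Lemma cff_on_bin_le (R : realType) (T I : finType) (S : T -> {set I})
    (k d e : nat) (V : {set I}) (P : {set T}) (a : R) :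
  cff_on S k (d + e) V P -> (k + (d + e) <= #|V|)%N -> (0 < d)%N -> 0 <= a ->
  #|P|%:R <= expR a ->
  'C(#|V| - d, k)%:R
    <= #|P|%:R * (1 + (#|V|%:R * a / d%:R) ^+ k / ((k`!)%:R * e.+1%:R)).
Proof.
move=> cf lV d0 a0 tP; set n := #|V|; set M := n%:R * a / d%:R.
have n0 : (0 < n)%N.
  by apply: leq_trans lV; apply: leq_trans (leq_addl _ _); apply: ltn_addr.
have M0 : 0 <= M by rewrite !mulr_ge0 // invr_ge0.
pose m := Num.truncn M; have [mM Mm] : m%:R <= M /\ M < m.+1%:R.
  by apply/andP; rewrite truncn_itv.
have few : (#|P| * (n - m.+1) ^ d < n ^ d)%N.
  (* If [n <= m.+1], truncated subtraction gives 0 and [0 < d] makes the product vanish. *)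
  have [le_nm|lt_mn] := leqP n m.+1.
    have -> : (n - m.+1 = 0)%N by apply/eqP; rewrite subn_eq0.
    by rewrite exp0n // muln0 expn_gt0 n0.
  rewrite -(ltr_nat R) natrM !natrX natrB ?(ltnW lt_mn) //.
  have nR : 0 < n%:R :> R by rewrite ltr0n.
  have P0 : 0 < #|P|%:R :> R by rewrite ltr0n; apply: cff_on_gt0 cf lV.
  have lt1 : n%:R - m.+1%:R < n%:R * expR (- (M / n%:R)) :> R.
    apply: lt_le_trans (_ : n%:R * (1 - M / n%:R) <= _); last first.
      by rewrite ler_pM2l // (le_trans _ (expR_ge1Dx _)).
    by rewrite mulrBr mulr1 mulrCA divff ?gt_eqF // mulr1 ltrD2l ltrN2.
  have lt2 : (n%:R - m.+1%:R) ^+ d < (n%:R * expR (- (M / n%:R))) ^+ d :> R.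
    by rewrite ltrXn2r -?lt0n // ?subr_ge0 ?ler_nat 1?ltnW.
  apply: lt_le_trans (_ : #|P|%:R * (n%:R * expR (- (M / n%:R))) ^+ d <= _).
    by rewrite ltr_pM2l.
  rewrite exprMn -expRM_natl mulrCA ler_piMr ?exprn_ge0 //.
  have -> : d%:R * - (M / n%:R) = - a.
    by rewrite /M; field; rewrite !pnatr_eq0 -!lt0n n0.
  by rewrite expRN ler_pdivrMr ?expR_gt0 // mul1r.
have := card_ksubsets_leq cf lV few; rewrite -(ler_nat R) -/n natrM natrM natrD => h.
have e0 : 0 < e.+1%:R :> R by rewrite ltr0n.
rewrite -(ler_pM2r e0); apply: le_trans h _.
rewrite -mulrA ler_wpM2l // addrC mulrDl mul1r lerD2l.
have -> : M ^+ k / (k`!%:R * e.+1%:R) * e.+1%:R = M ^+ k / k`!%:R.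
  by rewrite invfM mulrA mulfVK ?gt_eqF.
apply: le_trans (bin_le_expr _ _ _) _; rewrite ler_wpM2r ?invr_ge0 //.
by apply: lerXn2r; rewrite // nnegrE.
Qed.

(** * The case w = k of the explicit bound *)

(* Since [L >= 1] forces [r >= 24], the hypothesis improves itself: [L >= 3], *)
(* then [r >= 6 ^ (k + 1)] and hence [L >= 3 k / 2].                          *)
Lemma log_bootstrap (R : realType) (k : nat) (L r : R) :
  (2 <= k)%N -> 1 <= L -> 0 < r -> ln r <= L ->
  2 * (k%:R + 1) * (2 * L) ^+ k <= r -> (3 * k%:R) ^+ k <= r.
Proof.
move=> k2 L1 r0 rL Lr.
have k2R : 2 <= k%:R :> R by rewrite (ler_nat R 2).
have pow_le (x : R) : 0 <= x -> x <= 2 * L -> 6 * x ^+ k <= r.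
  move=> x0 xL; apply: le_trans Lr.
  by apply: ler_pM; rewrite ?exprn_ge0 ?lerXn2r ?nnegrE; lra.
have L3 : 3 <= L.
  apply: le_trans rL; rewrite -ler_expR lnK //.
  apply: le_trans (expR3_le24 R) (le_trans _ (pow_le 2 _ _)); [|lra..].
  have : (2 : R) ^+ 2 <= 2 ^+ k by rewrite ler_eXn2l ?ltr1n.
  lra.
have Lk : 3 * k%:R <= 2 * L.
  suff : (k.+1%:R * (3 / 2)) <= L by rewrite -natr1; lra.
  apply: le_trans rL; rewrite -ler_expR lnK // expRM_natl.
  apply: le_trans (_ : 6 ^+ k.+1 <= _); last first.
    have L6 : 6 <= 2 * L by lra.
    by rewrite exprS pow_le.
  apply: lerXn2r; rewrite ?nnegrE ?expR_ge0 //.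
  have : expR (3 / 2) ^+ 2 <= 6 ^+ 2 :> R.
    rewrite -expRM_natl; have -> : 2 * (3 / 2) = 3 :> R by lra.
    by have := expR3_le24 R; lra.
  by rewrite ler_sqr ?nnegrE ?expR_ge0 //; lra.
have := pow_le (3 * k%:R) ltac:(lra) Lk.
have : 0 <= (3 * k%:R) ^+ k :> R by rewrite exprn_ge0; lra.
lra.
Qed.

(** By contradiction: a smaller [t] satisfies [t <= r^(k+1) <= e^((k+1) L)], so [cff_on_bin_le]
    applies. Its error term [t * Q] is below [n^k / (2 k!)] and [Q >= 3], so its right side is below
    [(2/3) n^k / k!], which ['C(n - d, k)] reaches. [L] is only an upper bound on [ln r] since the
    later induction lowers [r] at fixed [L]. *)
Lemma cff_on_base (R : realType) (T I : finType) (S : T -> {set I})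
    (k r : nat) (V : {set I}) (P : {set T}) (L : R) :
  cff_on S k r V P -> (k + r <= #|V|)%N -> (r ^ k.+1 <= #|V| ^ k)%N ->
  (2 <= k)%N -> (0 < r)%N -> 1 <= L -> ln r%:R <= L ->
  k%:R ^+ k * (k`!)%:R / (2 * (k%:R + 1) ^+ (2 * k))
    * (r%:R ^+ k.+1 / ((k.+1)`!%:R * L ^+ k)) <= #|P|%:R.
Proof.
move=> cf lV rV k2 r0 L1 rL; rewrite leNgt; apply/negP.
set t : R := #|P|%:R; set n := #|V|.
have kR : 2 <= k%:R :> R by rewrite (ler_nat R 2).
have rR : 0 < r%:R :> R by rewrite ltr0n.
have F0 : 0 < (k`!)%:R :> R by rewrite ltr0n fact_gt0.
have n0 : 0 < n%:R :> R by rewrite ltr0n (leq_trans _ lV) // addn_gt0 r0 orbT.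
have p0 : 0 < k%:R ^+ k :> R by rewrite exprn_gt0; lra.
have q0 : 0 < (k%:R + 1) ^+ k :> R by rewrite exprn_gt0; lra.
have l1 : 1 <= L ^+ k by rewrite exprn_ege1.
have s0 : 0 < r%:R ^+ k :> R by rewrite exprn_gt0.
have pq : k%:R ^+ k <= (k%:R + 1) ^+ k :> R by apply: lerXn2r; rewrite ?nnegrE; lra.
have Fq : (k`!)%:R * 2 ^+ k <= (k%:R + 1) ^+ k :> R.
  by rewrite natr1 -!natrX -natrM ler_nat fact_exp2_le.
have c2 : 1 <= 2 ^+ k :> R by rewrite exprn_ege1 // ler1n.
have trivial_bound : r%:R ^+ k / (k`!)%:R <= t.
  by rewrite (le_trans (expr_le_bin R (leqnn (r + k)))) // ler_nat addnC (cff_on_bin cf).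
have t0 : 0 < t by rewrite ltr0n (cff_on_gt0 cf).
have nk : r%:R * r%:R ^+ k <= n%:R ^+ k :> R by rewrite -exprS -!natrX ler_nat.
have -> : k%:R ^+ k * (k`!)%:R / (2 * (k%:R + 1) ^+ (2 * k))
    * (r%:R ^+ k.+1 / ((k.+1)`!%:R * L ^+ k)) =
    k%:R ^+ k * r%:R * r%:R ^+ k
      / (2 * ((k%:R + 1) ^+ k) ^+ 2 * (k%:R + 1) * L ^+ k) :> R.
  rewrite factS natrM [(2 * k)%N]mulnC exprM (exprS r%:R) -(natr1 k).
  move: F0 q0 p0 s0 l1; move: (k`!)%:R ((k%:R + 1) ^+ k) (k%:R ^+ k) (r%:R ^+ k) (L ^+ k).
  move=> F q p s l *; field; rewrite !gt_eqF //; lra.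
rewrite ltr_pdivlMr; last by rewrite !mulr_gt0 ?exprn_gt0 //; lra.
move: trivial_bound; rewrite ler_pdivrMr // => tb small_t.
set F := (k`!)%:R in F0 Fq tb *; set p := _ ^+ k in p0 pq small_t.
set q := _ ^+ k in q0 pq Fq small_t; set s := _ ^+ k in s0 nk tb small_t.
set l := L ^+ k in l1 small_t.
have [Fge0 pge0 qge0 sge0] : [/\ 0 <= F, 0 <= p, 0 <= q & 0 <= s] by rewrite !ltW.
have lge0 : 0 <= l by lra.
have k1ge0 : 0 <= k%:R + 1 :> R by lra.
have tge0 := ltW t0.
(* Comparing the two bounds on [t] leaves only [r] superexponential in [k],   *)
(* which absorbs the lower-order terms into the factor 2.                     *)
have r_large : 2 * (k%:R + 1) * (2 ^+ k * l) <= r%:R.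
  have lt1 : s * (2 * q ^+ 2 * (k%:R + 1) * l) < s * (F * p * r%:R).
    apply: le_lt_trans (_ : t * F * (2 * q ^+ 2 * (k%:R + 1) * l) < _).
      by rewrite ler_wpM2r // !mulr_ge0 // exprn_ge0.
    have := small_t; rewrite -(ltr_pM2l F0); lra.
  move: lt1; rewrite ltr_pM2l // => lt1.
  rewrite -(ler_pM2l (exprn_gt0 2 q0)).
  apply: le_trans (_ : 2 ^+ k * (F * p * r%:R) <= _).
    have := lt1; rewrite -(ltr_pM2l (_ : 0 < 2 ^+ k)); lra.
  have -> : 2 ^+ k * (F * p * r%:R) = F * 2 ^+ k * p * r%:R by ring.
  by rewrite ler_wpM2r // expr2 ler_pM // mulr_ge0 // exprn_ge0.
have r_pow : (3 * k%:R) ^+ k <= r%:R :> R.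
  by apply: (log_bootstrap k2 L1 rR rL); rewrite exprMn.
(* Indeed [(3 k r)^k <= r * r^k <= n^k]. This gives [k r / n <= 1/3], the loss allowed in [binE]. *)
have n_large : 3 * k%:R * r%:R <= n%:R :> R.
  have : (3 * k%:R * r%:R) ^+ k <= n%:R ^+ k :> R.
    by rewrite exprMn (le_trans _ nk) // ler_wpM2r.
  by rewrite ler_pXn2r ?nnegrE ?mulr_ge0 // ltnW.
(* This says [k <= e] for the [e] below, hence [n - r + k <= n - d], as [expr_le_bin] requires. *)
have k_small : (k * k.+1 <= r)%N.
  rewrite -(ler_nat R) natrM -natr1; apply: le_trans r_pow.
  apply: le_trans (_ : (3 * k%:R) ^+ 2 <= _); first by nra.
  by rewrite ler_weXn2l //; lra.
(* Rounding costs nothing: [d >= k r / (k+1)], and [e + 1], the quantity that enters the bound, is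
   at least [r / (k+1)]. *)
pose e := (r %/ k.+1)%N; pose d := (r - e)%N.
have dE : (d + e)%N = r by rewrite subnK // leq_div.
have e_lb : (r <= k.+1 * e.+1)%N by rewrite mulnC ltnW // ltn_ceil.
have d_lb : (k * r <= k.+1 * d)%N.
  by have := leq_trunc_div r k.+1; rewrite -/e /d; clear; nia.
have k_le_e : (k <= e)%N by rewrite leq_divRL.
have d0 : (0 < d)%N.
  by move: d_lb; case: d {dE} => // ; rewrite muln0 leqn0 muln_eq0; clear -k2 r0; lia.
have tE : t <= expR ((k%:R + 1) * L).
  apply: le_trans (_ : r%:R ^+ k.+1 <= _); last first.
    rewrite natr1 expRM_natl; apply: lerXn2r; rewrite ?nnegrE ?expR_ge0 //.
    by rewrite -[leLHS]lnK // ler_expR.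
  rewrite exprS -(ler_pM2l p0) mulrA -/s (le_trans _ (ltW small_t)) // mulrC ler_pM2l //.
  apply: le_trans pq _.
  have q1 : 1 <= q by rewrite exprn_ege1 //; lra.
  have kl1 : 1 <= (k%:R + 1) * l by apply: mulr_ege1 => //; lra.
  have qq : q <= q * q by rewrite ler_peMr.
  have : q * 1 <= q * q * ((k%:R + 1) * l) by apply: ler_pM.
  have : 0 <= q * q * ((k%:R + 1) * l) by rewrite !mulr_ge0.
  have -> : 2 * q ^+ 2 * (k%:R + 1) * l = 2 * (q * q * ((k%:R + 1) * l)) by ring.
  move: (q * q * _) => x *; lra.
rewrite -{1}dE in cf; rewrite -dE in lV.
have := cff_on_bin_le cf lV d0 _ tE => /(_ ltac:(apply: mulr_ge0; lra)).
rewrite -/n -/F -/t.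
(* The error term at [d = k r / (k+1)] and [e + 1 = r / (k+1)]; it cancels against the assumed bound
   on [t], leaving the 2 of the stated constant. *)
pose Q := n%:R ^+ k * q ^+ 2 * (k%:R + 1) * l / (F * p * r%:R * s).
have QE : (n%:R * ((k%:R + 1) * L) / d%:R) ^+ k / (F * e.+1%:R) <= Q.
  have dR : 0 < d%:R :> R by rewrite ltr0n.
  have eR : 0 < e.+1%:R :> R by rewrite ltr0n.
  have kr0 : 0 < k%:R * r%:R :> R by rewrite mulr_gt0 //; lra.
  have xy : n%:R * ((k%:R + 1) * L) / d%:R
      <= n%:R * ((k%:R + 1) ^+ 2 * L) / (k%:R * r%:R).
    rewrite ler_pdivrMr // mulrAC ler_pdivlMr //.
    move: d_lb; rewrite -(ler_nat R) !natrM -natr1 => d_lb.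
    have w0 : 0 <= n%:R * ((k%:R + 1) * L) by rewrite !mulr_ge0 //; lra.
    have := ler_wpM2l w0 d_lb; lra.
  have x0 : 0 <= n%:R * ((k%:R + 1) * L) / d%:R by rewrite !mulr_ge0 ?invr_ge0 //; lra.
  have xyk : (n%:R * ((k%:R + 1) * L) / d%:R) ^+ k
      <= n%:R ^+ k * (q ^+ 2 * l) / (p * s).
    rewrite [q ^+ 2]exprAC -!exprMn -exprVn -exprMn.
    by apply: lerXn2r; rewrite ?nnegrE // (le_trans x0 xy).
  have -> : Q = n%:R ^+ k * (q ^+ 2 * l) / (p * s) * ((k%:R + 1) / (F * r%:R)).
    by rewrite /Q; field; rewrite !gt_eqF.
  apply: ler_pM xyk _; rewrite ?exprn_ge0 // ?invr_ge0 ?mulr_ge0 //.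
  rewrite -[leLHS]div1r ler_pdivrMr ?mulr_gt0 // mulrAC ler_pdivlMr ?mulr_gt0 // mul1r.
  move: e_lb; rewrite -(ler_nat R) natrM -natr1 => e_lb.
  have := ler_wpM2l (ltW F0) e_lb; lra.
have Q3 : 3 <= Q.
  rewrite /Q ler_pdivlMr ?mulr_gt0 //.
  have -> : 3 * (F * p * r%:R * s) = r%:R * s * (F * p) * 3 by ring.
  have -> : n%:R ^+ k * q ^+ 2 * (k%:R + 1) * l = n%:R ^+ k * q ^+ 2 * ((k%:R + 1) * l).
    by ring.
  have Fq' : F <= q by apply: le_trans Fq; rewrite ler_peMr.
  have kl : 3 <= (k%:R + 1) * l.
    have : (k%:R + 1) * 1 <= (k%:R + 1) * l by rewrite ler_wpM2l //; lra.
    lra.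
  by rewrite expr2 !ler_pM // ?mulr_ge0.
have binE : (2 / 3) * (n%:R ^+ k / F) <= 'C(n - d, k)%:R.
  have rn : (r <= n)%N by apply: leq_trans lV; rewrite dE leq_addl.
  apply: le_trans (_ : (n - r)%:R ^+ k / F <= _); last first.
    by apply: expr_le_bin; rewrite -dE; move: rn; rewrite -dE; clear -k_le_e; lia.
  rewrite mulrA ler_pM2r ?invr_gt0 //.
  have -> : (n - r)%:R = n%:R * (1 - r%:R / n%:R) :> R.
    by rewrite natrB // mulrBr mulr1 mulrCA divff ?mulr1 // gt_eqF.
  rewrite exprMn mulrC ler_pM2l ?exprn_gt0 //.
  apply: le_trans (bernoulli k _); last first.
    by rewrite lerN2 ler_pdivrMr // mul1r ler_nat.
  have : k%:R * (r%:R / n%:R) <= 1 / 3 :> R by rewrite mulrA ler_pdivrMr //; lra.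
  lra.
have tQ : t * Q < n%:R ^+ k / F / 2.
  have -> : t * Q = n%:R ^+ k / (2 * F) / (p * r%:R * s)
      * (t * (2 * q ^+ 2 * (k%:R + 1) * l)).
    by rewrite /Q; field; rewrite !gt_eqF.
  apply: lt_le_trans (_ : n%:R ^+ k / (2 * F) / (p * r%:R * s) * (p * r%:R * s) <= _).
    rewrite ltr_pM2l // !mulr_gt0 ?invr_gt0 ?exprn_gt0 ?mulr_gt0 //.
  by rewrite mulfVK ?gt_eqF ?mulr_gt0 // invfM mulrAC mulrA.
move=> main.
have : t * (1 + Q) < (2 / 3) * (n%:R ^+ k / F).
  have : t * 3 <= t * Q by rewrite ler_pM2l.
  lra.
apply/negP; rewrite -leNgt; apply: le_trans binE (le_trans main _).
by rewrite ler_pM2l // lerD2l.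
Qed.

(** * Induction on w, and the trivial upper bound *)

(** [(r/(r+1))^(k+1) <= (r/(r+1))^k <= (y/(y+1))^k]. Spending a block on the forbidden side lowers
    both [r] and the number of blocks, and the size condition must survive this. *)
Lemma exp_pred_le (r y k : nat) :
  (r <= y)%N -> (r.+1 ^ k.+1 <= y.+1 ^ k)%N -> (r ^ k.+1 <= y ^ k)%N.
Proof.
move=> ry h; have y0 : (0 < y.+1 ^ k)%N by rewrite expn_gt0.
rewrite -(leq_pmul2r y0).
have step : ((r * y.+1) ^ k <= (r.+1 * y) ^ k)%N.
  by case: k {h y0} => // k; rewrite leq_exp2r //; nia.
rewrite expnS -mulnA -expnMn [leqRHS]mulnC.
apply: leq_trans (leq_mul h (leqnn _)).
by rewrite expnS -mulnA -expnMn leq_mul.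
Qed.

Lemma expS_le (a m : nat) : (a.+1 ^ m.+1 <= a ^ m.+1 + m.+1 * a.+1 ^ m)%N.
Proof.
elim: m => [|m IHm]; first by rewrite !expn1 expn0 muln1 addn1.
have h : (a ^ m.+1 <= a.+1 ^ m.+1)%N by rewrite leq_exp2r.
rewrite [leqLHS]expnS (expnS a m.+1).
apply: leq_trans (leq_mul (leqnn a.+1) IHm) _.
move: h; rewrite !(expnS a.+1); move: (a ^ _)%N (_ ^ m)%N => x z; clear; nia.
Qed.

(** Fixing a block adds the bounds for [(w-1, r)] and [(w, r-1)], and [expS_le] shows that their sum
    dominates the bound for [(w, r)]. In the first branch [#|V| - j] is unchanged; in the second
    [exp_pred_le] applies. *)
Lemma cff_on_lower (R : realType) (T I : finType) (S : T -> {set I}) (k : nat)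
    (L : R) (j r : nat) (V : {set I}) (P : {set T}) :
  (2 <= k)%N -> 1 <= L -> r%:R <= expR L ->
  cff_on S (k + j) r V P -> (k + j + r <= #|V|)%N ->
  (r ^ k.+1 <= (#|V| - j) ^ k)%N ->
  k%:R ^+ k * (k`!)%:R / (2 * (k%:R + 1) ^+ (2 * k))
    * (r%:R ^+ (k + j).+1 / (((k + j).+1)`!%:R * L ^+ k)) <= #|P|%:R.
Proof.
move=> k2 L1; set c := (X in X * _).
have c0 : 0 <= c.
  by rewrite /c divr_ge0 // ?mulr_ge0 ?exprn_ge0 ?addr_ge0.
have l0 : 0 < L ^+ k by rewrite exprn_gt0; lra.
elim: j r V P => [|j IHj] r V P.
  rewrite addn0 subn0 => rL cf lV rV.
  case: r => [|r] in rL cf lV rV *; first by rewrite expr0n mul0r mulr0.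
  by apply: (cff_on_base cf) => //; rewrite -ler_expR lnK // posrE.
elim: r V P => [|r IHr] V P rL cf lV rV; first by rewrite expr0n mul0r mulr0.
have /card_gt0P[i iV]: (0 < #|V|)%N by apply: leq_trans lV; rewrite addnS.
have cV : #|V| = #|V :\ i|.+1 by rewrite (cardsD1 i) iV.
rewrite cV in lV rV; rewrite addnS in cf lV.
have le1 := IHj _ _ _ rL (cff_on_mem cf iV) ltac:(lia) ltac:(by rewrite subSS in rV).
have rV' : (r ^ k.+1 <= (#|V :\ i| - j.+1) ^ k)%N.
  apply: exp_pred_le; first by clear -lV; lia.
  by rewrite -subSn //; clear -lV; lia.
have rL' : r%:R <= expR L by rewrite (le_trans _ rL) // ler_nat.
have le2 := IHr _ _ rL' ltac:(by rewrite addnS; exact: cff_on_nmem cf iV) ltac:(lia) rV'.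
rewrite -(cardsID [set x | i \in S x] P) natrD; apply: le_trans (lerD le1 le2).
rewrite addnS -mulrDr ler_wpM2l // [(_.+2)`!]factS natrM.
set m := (k + j).+1; set f := (m`!)%:R.
have f0 : 0 < f :> R by rewrite ltr0n fact_gt0.
have m0 : 0 < m.+1%:R :> R by rewrite ltr0n.
have -> : r.+1%:R ^+ m / (f * L ^+ k) + r%:R ^+ m.+1 / (m.+1%:R * f * L ^+ k)
    = (m.+1%:R * r.+1%:R ^+ m + r%:R ^+ m.+1) / (m.+1%:R * f * L ^+ k).
  rewrite [RHS]mulrDl; congr GRing.add.
  by rewrite -[in RHS](mulrA _ f) [in RHS]invfM [RHS]mulrACA divff ?gt_eqF // mul1r.
rewrite ler_pM2r ?invr_gt0 ?mulr_gt0 //.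
by rewrite -!natrX -natrM -natrD ler_nat addnC expS_le.
Qed.

Lemma cffN_cff_on (n w r : nat) :
  exists2 F : {set {set 'I_(cffN n w r)}}, #|F| = n &
    cff_on (fun x => [set A : {set 'I_(cffN n w r)} | x \in A]) w r F setT.
Proof.
rewrite /cffN; case: ex_minnP => t /existsP[F /andP[/eqP cF /forallP cf]] _.
exists F => // A B sA sB cA cB dAB.
have /forallP/(_ B)/implyP := cf A; rewrite sA sB cA cB !eqxx dAB => /(_ isT).
case/subsetPn => x /bigcapP xA /bigcupP xB; exists x => //.
apply/andP; split; first by apply/subsetP => U UA; rewrite inE xA.
rewrite -setI_eq0; apply/eqP/setP => U; rewrite !inE; apply/negP => /andP[xU UB].
by apply: xB; exists U.
Qed.

(** The points are the [w]-subsets of the indices, block [i] being those that contain [i]: any [w]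
    blocks share exactly one point, which lies on no other block. The bounds on [w] make distinct
    indices give distinct blocks. *)
Lemma cffN_le_bin (n w r : nat) : (0 < w < n)%N -> (cffN n w r <= 'C(n, w))%N.
Proof.
move=> /andP[w0 wn]; pose Ws := [set W : {set 'I_n} | #|W| == w].
have cWs : #|Ws| = 'C(n, w) by rewrite card_draws card_ord.
rewrite /cffN; case: ex_minnP => t _; apply; rewrite -cWs; apply/existsP.
have rank W : W \in Ws -> exists p : 'I_#|Ws|, enum_val p = W.
  by move=> WW; exists (enum_rank_in WW W); rewrite enum_rankK_in.
pose blk (i : 'I_n) : {set 'I_#|Ws|} := [set p | i \in (enum_val p : {set 'I_n})].
have blk_inj : injective blk.
  move=> i j; apply: contra_eq => ij.
  have [||W [iW Wj] cW] := @subset_of_card _ [set i] [set~ j] w.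
  - by rewrite sub1set !inE.
  - by rewrite cards1 w0 cardsC1 card_ord; lia.
  have [|p pW] := rank W; first by rewrite inE cW.
  apply/negP => /eqP/setP/(_ p); rewrite !inE pW -sub1set iW => /esym/(subsetP Wj).
  by rewrite !inE eqxx.
exists [set blk i | i in 'I_n]; apply/andP; split.
  by rewrite card_imset // card_ord.
apply/forallP => A; apply/forallP => B; apply/implyP.
case/and5P => /subsetP sA /subsetP sB /eqP cA _ dAB.
pose J := [set i | blk i \in A].
have AJ : A = blk @: J.
  apply/setP => U; apply/idP/imsetP => [UA|[i]]; last by rewrite inE => ? ->.
  by have /imsetP[i _ UE] := sA _ UA; exists i; rewrite // inE -UE.
have [|p pJ] := rank J; first by rewrite inE -cA AJ card_imset.
apply/subsetPn; exists p.
  by rewrite AJ; apply/bigcapP => _ /imsetP[i iJ ->]; rewrite inE pJ.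
apply/bigcupP => -[U UB]; have /imsetP[i _ UE] := sB _ UB.
rewrite UE inE pJ inE -UE => UA.
by move/disjointFr: dAB => /(_ _ UA); rewrite UB.
Qed.

(** * Lower bound on the constant *)

Lemma expR_ge_quad (R : realType) (x : R) : 0 <= x -> 1 + x + x ^+ 2 / 2 <= expR x.
Proof.
move=> x0; have -> : 1 + x + x ^+ 2 / 2 = series (exp_coeff x) 3%N.
  rewrite /series /= !big_nat_recr // big_nil /= /exp_coeff /= !factS fact0.
  by rewrite expr0 expr1; field.
apply: nondecreasing_cvgn_le; last exact: is_cvg_series_exp_coeff.
by apply: nondecreasing_series => i _ _; apply: exp_coeff_ge0.
Qed.

(* The induction step is [e ^ 2 >= (1 + 1/k) ^ (2 k) * (1 + 1 / (k + 1))].    *)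
Lemma stirling_sq (R : realType) (k : nat) :
  (k%:R + 1) * (k%:R ^+ k) ^+ 2 <= ((k`!)%:R * expR 1 ^+ k) ^+ 2 :> R.
Proof.
elim: k => [|k IHk]; first by rewrite !expr0 add0r mul1r mulr1.
have [->|k0] := posnP k.
  have := expR_ge1Dx (1 : R); rewrite expr1 factS fact0 expr1n !mulr1 mul1r.
  nra.
have kR : 0 < k%:R :> R by rewrite ltr0n.
set x : R := k%:R in kR IHk *.
have xge0 := ltW kR; have xi0 : 0 <= x^-1 by rewrite invr_ge0.
(* Chosen so that [(1 + 1/x)(1 + z) = 1 + 1/x + 1/(2 x^2)] and [1 + 2 x z = 1 + 1/(x+1)]. *)
pose z : R := (2 * x * (x + 1))^-1.
have z0 : 0 <= z by rewrite invr_ge0; nra.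
have zN1 : -1 <= z by lra.
have e1 : (1 + x^-1) * (1 + z) <= expR x^-1.
  apply: le_trans (expR_ge_quad _); last by rewrite invr_ge0 ltW.
  rewrite le_eqVlt; apply/orP; left; apply/eqP; rewrite /z.
  by field; rewrite !gt_eqF //; nra.
have e2 : (1 + x^-1) ^+ (2 * k) * (1 + (x + 1)^-1) <= expR 1 ^+ 2.
  have -> : expR 1 ^+ 2 = expR x^-1 ^+ (2 * k) :> R.
    rewrite -!expRM_natl natrM -/x; congr expR.
    by rewrite -mulrA divff ?gt_eqF.
  apply: le_trans (_ : ((1 + x^-1) * (1 + z)) ^+ (2 * k) <= _).
    rewrite exprMn ler_wpM2l ?exprn_ge0 ?addr_ge0 //.
    apply: le_trans (bernoulli _ zN1); rewrite le_eqVlt.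
    apply/orP; left; apply/eqP; rewrite natrM -/x /z.
    by field; rewrite !gt_eqF //; nra.
  apply: lerXn2r => //; rewrite nnegrE ?expR_ge0 // mulr_ge0 ?addr_ge0 //.
have xk : (1 + x^-1) ^+ (2 * k) * (x ^+ k) ^+ 2 = ((x + 1) ^+ k) ^+ 2.
  rewrite mulnC exprM -!exprMn; congr ((_ ^+ k) ^+ 2).
  by field; rewrite gt_eqF.
rewrite factS natrM (exprS k.+1%:R) -(natr1 k) -/x [expR 1 ^+ k.+1]exprS.
have -> : (x + 1 + 1) * ((x + 1) * (x + 1) ^+ k) ^+ 2 =
    (x + 1) ^+ 3 * ((1 + x^-1) ^+ (2 * k) * (1 + (x + 1)^-1)) * (x ^+ k) ^+ 2.
  have -> : forall u v w y : R, u * (v * w) * y = u * (v * y) * w by move=> *; ring.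
  rewrite xk; move: (_ ^+ k) => y; field; rewrite gt_eqF //; lra.
have -> : ((x + 1) * k`!%:R * (expR 1 * expR 1 ^+ k)) ^+ 2 =
    (x + 1) ^+ 2 * expR 1 ^+ 2 * (k`!%:R * expR 1 ^+ k) ^+ 2 :> R by ring.
have -> : (x + 1) ^+ 3 * ((1 + x^-1) ^+ (2 * k) * (1 + (x + 1)^-1)) * (x ^+ k) ^+ 2 =
   (x + 1) ^+ 2 * ((1 + x^-1) ^+ (2 * k) * (1 + (x + 1)^-1)) * ((x + 1) * (x ^+ k) ^+ 2).
  by ring.
have x1 : 0 <= x + 1 by lra.
apply: ler_pM IHk.
- by rewrite !mulr_ge0 ?exprn_ge0 ?addr_ge0 ?invr_ge0 //.
- by rewrite !mulr_ge0 ?exprn_ge0.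
- by rewrite ler_wpM2l ?exprn_ge0.
Qed.

(** Stirling gives [sqrt k * k^k <= k! e^k], and [(1 + 1/k)^(2k) <= e^2] accounts for the factor
    [2 e^2]. *)
Lemma constant_lower (R : realType) (k : nat) : (0 < k)%N ->
  Num.sqrt k%:R / expR k%:R / (2 * expR 1 ^+ 2)
    <= k%:R ^+ k * (k`!)%:R / (2 * (k%:R + 1) ^+ (2 * k)) :> R.
Proof.
move=> k0; have kR : 0 < k%:R :> R by rewrite ltr0n.
set E : R := expR 1; have E0 : 0 < E by apply: expR_gt0.
have eE : expR k%:R = E ^+ k by rewrite -expRM_natl mulr1.
have p0 : 0 < k%:R ^+ k :> R by rewrite exprn_gt0.
have st : Num.sqrt k%:R * k%:R ^+ k <= (k`!)%:R * E ^+ k.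
  rewrite -ler_sqr ?nnegrE ?mulr_ge0 ?sqrtr_ge0 ?exprn_ge0 ?(ltW E0) //.
  rewrite exprMn (sqr_sqrtr (ltW kR)); apply: le_trans (stirling_sq R k).
  by rewrite ler_wpM2r ?exprn_ge0 ?lerDl.
have q_le : (k%:R + 1) ^+ (2 * k) <= E ^+ 2 * (k%:R ^+ k) ^+ 2.
  have -> : E = expR k%:R^-1 ^+ k by rewrite -expRM_natl divff ?gt_eqF.
  rewrite -exprMn -exprMn mulnC exprM.
  apply: lerXn2r; rewrite ?nnegrE ?exprn_ge0 ?addr_ge0 ?mulr_ge0 ?expR_ge0 //.
  apply: lerXn2r; rewrite ?nnegrE ?addr_ge0 ?mulr_ge0 ?expR_ge0 //.
  have := ler_wpM2r (ltW kR) (expR_ge1Dx (k%:R^-1 : R)).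
  by rewrite mulrDl mulVf ?gt_eqF // mul1r.
have q0 : 0 < (k%:R + 1) ^+ (2 * k) :> R by rewrite exprn_gt0 //; lra.
rewrite eE -mulrA -invfM ler_pdivrMr ?mulr_gt0 ?exprn_gt0 //.
rewrite mulrAC ler_pdivlMr ?mulr_gt0 //.
rewrite -(ler_pM2r p0).
apply: le_trans (_ : (k`!)%:R * E ^+ k * (2 * (k%:R + 1) ^+ (2 * k)) <= _).
  by rewrite mulrAC ler_wpM2r // ltW // mulr_gt0.
have w0 : 0 <= 2 * (k`!)%:R * E ^+ k by rewrite !mulr_ge0 ?exprn_ge0 // ltW.
have := ler_wpM2l w0 q_le.
move: (k%:R ^+ k) (_ ^+ (2 * k)) => p q; lra.
Qed.

(** * Bounds on N(n,(w,r)) *)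

Lemma powR_fracK (R : realType) (x : R) (a : nat) :
  0 <= x -> (x `^ (a%:R / (a%:R + 1))) ^+ a.+1 = x ^+ a.
Proof.
move=> x0; rewrite -(powR_mulrn a.+1) ?powR_ge0 // -powRrM -natr1 mulfVK.
  by rewrite powR_mulrn.
by rewrite natr1 pnatr_eq0.
Qed.

Lemma half_le_nat (R : realType) (r n : nat) :
  r%:R <= n%:R / 2 :> R -> (2 * r <= n)%N.
Proof. by rewrite -(ler_nat R) natrM; lra. Qed.

Lemma cffN_lower (R : realType) (k w r n : nat) :
  (2 <= k <= w)%N -> (w < r)%N -> r%:R <= n%:R / 2 :> R ->
  r%:R <= (n%:R + k%:R - w%:R) `^ (k%:R / (k%:R + 1)) :> R ->
  k%:R ^+ k * (k`!)%:R / (2 * (k%:R + 1) ^+ (2 * k))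
    * (r%:R ^+ w.+1 / ((w.+1)`!%:R * ln r%:R ^+ k)) <= (cffN n w r)%:R :> R.
Proof.
move=> /andP[k2 kw] wr /half_le_nat rn.
have yE : n%:R + k%:R - w%:R = (n - (w - k))%:R :> R.
  by rewrite !natrB ?(leq_trans (leq_subr _ _)) //; [ring | lia].
rewrite yE => ub; have rV : (r ^ k.+1 <= (n - (w - k)) ^ k)%N.
  by rewrite -(ler_nat R) !natrX -[leRHS]powR_fracK //; apply: lerXn2r; rewrite ?nnegrE ?powR_ge0.
have [F cF cf] := cffN_cff_on n w r.
have r0 : 0 < r%:R :> R by rewrite ltr0n; lia.
(* Here [r >= 3 >= e], the latter because [e^3 <= 24 <= 3^3]. *)
have L1 : 1 <= ln r%:R :> R.
  rewrite -ler_expR lnK //; apply: le_trans (_ : 3 <= _); last first.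
    by rewrite (ler_nat R 3); lia.
  have : expR 1 ^+ 3 <= 3 ^+ 3 :> R.
    by rewrite -expRM_natl mulr1; have := expR3_le24 R; lra.
  by rewrite ler_pXn2r ?nnegrE ?expR_ge0.
have rL : r%:R <= expR (ln r%:R) :> R by rewrite lnK.
have cf' := cf; rewrite -[X in cff_on _ X](subnKC kw) in cf'.
have := cff_on_lower k2 L1 rL cf'; rewrite subnKC // cF cardsT card_ord.
by apply => //; clear -rn wr; lia.
Qed.

(** The exponent [(k-1)/k] is at least 1/2 and its base at least [n/2], so [n <= 2 r^2 <= r^3] and
    [ln n <= 3 ln r]; the constant is this 3 times the [2 e^2] of [constant_lower]. *)
Lemma bounds_compare (R : realType) (k w r n : nat) :
  (2 <= k <= w)%N -> (w < r)%N -> r%:R <= n%:R / 2 :> R ->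
  (n%:R + k%:R - 1 - w%:R) `^ ((k%:R - 1) / k%:R) <= r%:R :> R ->
  (6 * expR 1 ^+ 2)^-1 * (Num.sqrt k%:R / expR k%:R
    * (r%:R ^+ w.+1 / ((w.+1)`!%:R * ln r%:R ^+ k.+1)) * ln n%:R)
  <= k%:R ^+ k * (k`!)%:R / (2 * (k%:R + 1) ^+ (2 * k))
       * (r%:R ^+ w.+1 / ((w.+1)`!%:R * ln r%:R ^+ k)) :> R.
Proof.
move=> /andP[k2 kw] wr rn lb.
have kR : 2 <= k%:R :> R by rewrite (ler_nat R 2).
have r3 : 3 <= r%:R :> R by rewrite (ler_nat R 3); lia.
have wrR : w%:R + 1 <= r%:R :> R by rewrite natr1 ler_nat.
have lr : 0 < ln r%:R :> R by rewrite ln_gt0; lra.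
have ln3 : ln n%:R <= 3 * ln r%:R :> R.
  set y := _ - w%:R in lb; have yn : n%:R / 2 <= y by rewrite /y; lra.
  have : y <= r%:R ^+ 2.
    apply: le_trans (_ : (y `^ ((k%:R - 1) / k%:R)) ^+ 2 <= _); last first.
      by apply: lerXn2r; rewrite ?nnegrE ?powR_ge0.
    rewrite -(powR_mulrn 2) ?powR_ge0 // -powRrM -[leLHS]powRr1; last by lra.
    apply: ler_powR; first by lra.
    rewrite mulrAC ler_pdivlMr; lra.
  move=> yr; have -> : 3 * ln r%:R = ln (r%:R ^+ 3) :> R.
    by rewrite lnXn ?mulr_natl //; lra.
  rewrite ler_ln ?posrE ?exprn_gt0 //; [|lra..].
  apply: le_trans (_ : 2 * r%:R ^+ 2 <= _); first by lra.
  by rewrite exprS ler_wpM2r ?exprn_ge0 //; lra.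
set X := r%:R ^+ w.+1 / (_ * ln r%:R ^+ k).
have X0 : 0 <= X by rewrite /X divr_ge0 ?mulr_ge0 ?exprn_ge0 // ltW.
have -> : r%:R ^+ w.+1 / ((w.+1)`!%:R * ln r%:R ^+ k.+1) = X / ln r%:R.
  by rewrite /X (exprSr (ln _)) mulrA [in LHS]invfM mulrA.
have E0 : 0 < expR 1 ^+ 2 :> R by rewrite exprn_gt0 // expR_gt0.
have := constant_lower R (ltnW k2) => /(ler_wpM2r X0); apply: le_trans.
set s := Num.sqrt _ / _; have s0 : 0 <= s by rewrite divr_ge0 ?sqrtr_ge0 ?expR_ge0.
have sX : 0 <= s * X by apply: mulr_ge0.
have -> : (6 * expR 1 ^+ 2)^-1 * (s * (X / ln r%:R) * ln n%:R)
    = s * X / (6 * expR 1 ^+ 2) * (ln n%:R / ln r%:R) :> R.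
  by field; rewrite gt_eqF //= gt_eqF // expR_gt0.
apply: le_trans (_ : s * X / (6 * expR 1 ^+ 2) * 3 <= _).
  by rewrite ler_wpM2l ?ler_pdivrMr // divr_ge0 // mulr_ge0 // ltW.
by rewrite le_eqVlt; apply/orP; left; apply/eqP; field; rewrite gt_eqF // expR_gt0.
Qed.

(** The trivial bound [t <= 'C(n, w) <= n^w] allows [a = w ln n]. With [d] about [r/2], the error
    term is at most [2 (3w)^w (n ln n)^w / r^(w+1)], bounded by the hypothesis on [r]. *)
Lemma cffN_bin_lower (R : realType) (w r n : nat) (c : R) :
  (1 <= w)%N -> 0 < c -> (2 <= r)%N -> (w < r)%N -> r%:R <= n%:R / 2 :> R ->
  c * (n%:R * ln n%:R) `^ (w%:R / (w%:R + 1)) <= r%:R ->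
  'C(n, w)%:R <= (cffN n w r)%:R
    * (4 ^+ w * (1 + 2 * (3 * w%:R) ^+ w / c ^+ w.+1)) :> R.
Proof.
move=> w1 c0 r2 wr /half_le_nat rn lb.
have [F cF cf] := cffN_cff_on n w r.
pose d := (r %/ 2)%N; pose e := (r - d)%N.
have d0 : (0 < d)%N by rewrite divn_gt0.
have dr : (d <= r)%N by apply: leq_div.
have dE : (d + e)%N = r by rewrite subnKC.
have r3d : (r <= 3 * d)%N by rewrite /d; clear -r2; lia.
have d2r : (2 * d <= r)%N by rewrite /d; clear; lia.
have r2e : (r <= 2 * e.+1)%N by rewrite /e; clear -d2r; lia.
have n1 : (1 < n)%N by clear -rn r2; lia.
have lnn : 0 <= ln n%:R :> R by rewrite ln_ge0 // ler1n ltnW.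
have nR : 0 < n%:R :> R by rewrite ltr0n ltnW.
have rR : 0 < r%:R :> R by rewrite ltr0n ltnW.
have wR : 0 <= w%:R :> R by [].
have a0 : 0 <= w%:R * ln n%:R :> R by apply: mulr_ge0.
have tE : #|[set: 'I_(cffN n w r)]|%:R <= expR (w%:R * ln n%:R) :> R.
  rewrite cardsT card_ord expRM_natl lnK //.
  apply: le_trans (_ : 'C(n, w)%:R <= _).
    by rewrite ler_nat cffN_le_bin // w1 /=; clear -rn wr; lia.
  apply: le_trans (bin_le_expr _ _ _) _.
  by rewrite ler_pdivrMr ?ltr0n ?fact_gt0 // ler_peMr ?exprn_ge0 // ler1n fact_gt0.
rewrite -[X in cff_on _ _ X]dE in cf; have := cff_on_bin_le cf _ d0 a0 tE.
rewrite cF cardsT card_ord dE => /(_ ltac:(clear -rn wr; lia)).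
set t : R := (cffN n w r)%:R; have t0 : 0 <= t by [].
set f : R := (w`!)%:R; have f1 : 1 <= f by rewrite ler1n fact_gt0.
move=> main.
have Mle : (n%:R * (w%:R * ln n%:R) / d%:R) ^+ w / (f * e.+1%:R)
    <= 2 * (3 * w%:R) ^+ w / c ^+ w.+1.
  have h : (n%:R * ln n%:R) ^+ w <= (r%:R / c) ^+ w.+1.
    rewrite -[leLHS]powR_fracK ?mulr_ge0 //.
    apply: lerXn2r; rewrite ?nnegrE ?powR_ge0 ?divr_ge0 ?(ltW c0) //.
    by rewrite ler_pdivlMr // mulrC.
  have dR : 0 < d%:R :> R by rewrite ltr0n.
  have nl0 : 0 <= n%:R * ln n%:R :> R by apply: mulr_ge0.
  have h1 : (n%:R * (w%:R * ln n%:R) / d%:R) ^+ w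
      <= (3 * w%:R) ^+ w * (n%:R * ln n%:R) ^+ w / r%:R ^+ w :> R.
    rewrite -exprMn -expr_div_n; apply: lerXn2r.
    - by rewrite nnegrE !mulr_ge0 ?invr_ge0.
    - by rewrite nnegrE !mulr_ge0 ?invr_ge0.
    rewrite ler_pdivrMr // mulrAC ler_pdivlMr //.
    have -> : n%:R * (w%:R * ln n%:R) * r%:R
        = w%:R * (n%:R * ln n%:R) * r%:R :> R by ring.
    have -> : 3 * w%:R * (n%:R * ln n%:R) * d%:R
        = w%:R * (n%:R * ln n%:R) * (3 * d%:R) :> R by ring.
    by rewrite ler_wpM2l ?mulr_ge0 // -natrM ler_nat.
  have h2 : (f * e.+1%:R)^-1 <= 2 / r%:R.
    rewrite -[leLHS]div1r ler_pdivrMr ?mulr_gt0 ?(lt_le_trans ltr01 f1) //.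
    rewrite mulrAC ler_pdivlMr // mul1r mulrCA.
    apply: le_trans (_ : 2 * e.+1%:R <= _); first by rewrite -natrM ler_nat.
    by rewrite ler_peMl // mulr_ge0.
  apply: le_trans (ler_pM _ _ h1 h2) _.
  - by rewrite exprn_ge0 ?divr_ge0 ?mulr_ge0.
  - by rewrite invr_ge0 mulr_ge0 // (le_trans ler01 f1).
  apply: le_trans
    (_ : (3 * w%:R) ^+ w * (r%:R / c) ^+ w.+1 / r%:R ^+ w * (2 / r%:R) <= _).
    rewrite ler_wpM2r ?divr_ge0 // ler_wpM2r ?invr_ge0 ?exprn_ge0 //.
    by rewrite ler_wpM2l ?exprn_ge0 ?mulr_ge0.
  rewrite expr_div_n exprS; rewrite le_eqVlt; apply/orP; left; apply/eqP.
  have rw0 : r%:R ^+ w != 0 :> R by rewrite expf_neq0 ?gt_eqF.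
  have cw0 : c ^+ w.+1 != 0 by rewrite expf_neq0 ?gt_eqF.
  move: (r%:R ^+ w) (c ^+ w.+1) rw0 cw0 => u v u0 v0.
  by field; rewrite u0 v0 gt_eqF.
(* As [d <= r/2 <= n/4] and [w < n/2], at least [n/4] remains of [n - d - w]. *)
have big : (n%:R / 4) ^+ w / f <= 'C(n - d, w)%:R.
  apply: le_trans (expr_le_bin R (_ : (n - d - w) + w <= n - d)%N); last first.
    by clear -rn wr d2r; lia.
  rewrite ler_pM2r ?invr_gt0 ?(lt_le_trans ltr01 f1) //; apply: lerXn2r.
  - by rewrite nnegrE divr_ge0.
  - by rewrite nnegrE.
  rewrite ler_pdivrMr // -natrM ler_nat; clear -rn wr d2r; lia.
apply: le_trans (bin_le_expr _ _ _) _; rewrite -/f.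
have -> : n%:R ^+ w / f = 4 ^+ w * ((n%:R / 4) ^+ w / f).
  by rewrite mulrA -exprMn [4 * _]mulrC divfK // pnatr_eq0.
rewrite [leRHS]mulrCA ler_wpM2l ?exprn_ge0 //.
apply: le_trans big (le_trans main _).
by rewrite ler_wpM2l // lerD2l.
Qed.

Theorem theorem1 (R : realType) :
  (forall k w r n : nat,
     (2 <= k <= w)%N -> (w < r)%N -> r%:R <= n%:R / 2 :> R ->
     (n%:R + k%:R - 1 - w%:R) `^ ((k%:R - 1) / k%:R) <= r%:R :> R ->
     r%:R <= (n%:R + k%:R - w%:R) `^ (k%:R / (k%:R + 1)) :> R ->
     k%:R ^+ k * (k`!)%:R / (2 * (k%:R + 1) ^+ (2 * k))
       * (r%:R ^+ w.+1 / ((w.+1)`!%:R * ln r%:R ^+ k))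
     <= (cffN n w r)%:R :> R)
  /\
  (exists2 c : R, 0 < c & exists m : nat, forall k w r n : nat,
     (m <= r)%N -> (m <= n)%N ->
     (2 <= k <= w)%N -> (w < r)%N -> r%:R <= n%:R / 2 :> R ->
     (n%:R + k%:R - 1 - w%:R) `^ ((k%:R - 1) / k%:R) <= r%:R :> R ->
     r%:R <= (n%:R + k%:R - w%:R) `^ (k%:R / (k%:R + 1)) :> R ->
     c * (Num.sqrt k%:R / expR k%:R
            * (r%:R ^+ w.+1 / ((w.+1)`!%:R * ln r%:R ^+ k.+1)) * ln n%:R)
     <= k%:R ^+ k * (k`!)%:R / (2 * (k%:R + 1) ^+ (2 * k))
          * (r%:R ^+ w.+1 / ((w.+1)`!%:R * ln r%:R ^+ k)))
  /\
  (forall w : nat, (1 <= w)%N -> forall c : R, 0 < c ->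
     exists c1 c2 : R, [/\ 0 < c1, 0 < c2 &
       exists m : nat, forall r n : nat,
         (m <= r)%N -> (m <= n)%N ->
         (w < r)%N -> r%:R <= n%:R / 2 :> R ->
         c * (n%:R * ln n%:R) `^ (w%:R / (w%:R + 1)) <= r%:R ->
         c1 * 'C(n, w)%:R <= (cffN n w r)%:R /\
         (cffN n w r)%:R <= c2 * 'C(n, w)%:R]).
Proof.
split; first by move=> k w r n kw wr rn _; apply: cffN_lower.
split.
  exists (6 * expR 1 ^+ 2)^-1.
    by rewrite invr_gt0 mulr_gt0 // exprn_gt0 // expR_gt0.
  by exists 0%N => k w r n _ _ kw wr rn lb _; apply: bounds_compare.
move=> w w1 c c0; pose K : R := 4 ^+ w * (1 + 2 * (3 * w%:R) ^+ w / c ^+ w.+1).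
have K0 : 0 < K.
  rewrite mulr_gt0 ?exprn_gt0 // ltr_wpDr // divr_ge0 ?mulr_ge0 ?exprn_ge0 ?mulr_ge0 //.
  exact: ltW.
exists K^-1, 1; split; rewrite ?invr_gt0 //; exists 2%N => r n r2 _ wr rn lb; split.
  by rewrite mulrC ler_pdivrMr //; apply: cffN_bin_lower.
rewrite mul1r ler_nat cffN_le_bin // w1 /=.
by have := half_le_nat rn; clear -wr; lia.
Qed.
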